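(* Let $I\subset\mathbb{R}$ be a non-degenerate interval, let $f_n: I\to I$ be a $C^{1}$ map for each $n\geq 0$, and let $\Lambda$ be a totally invariant non-degenerate subinterval in $I$; that is, $f_n(\Lambda)\subset\Lambda$ for all $n\geq 0$. Assume that $\{f_n'\}_{n=0}^{\infty}$ is equi-continuous in $\Lambda$, and that there exists $M>0$ such that for any $x\in\Lambda$, $|f_n'(x)|\geq M$ for all $n\geq 0$. If $\lambda:=\inf_{x\in\Lambda}\lambda(x)>0$, where $\lambda(x)$ is the Lyapunov exponent at $x$, then the non-autonomous system $x_{n+1}=f_n(x_n)$, $n\geq 0$, is strongly sensitive in $\Lambda$.
   Context: Write $f_0^n:=f_{n-1}\circ\cdots\circ f_0$ for $n\ge 1$ and $f_0^0=\mathrm{id}$. Equi-continuity: a sequence of maps $h_n$, $n\ge 0$, each uniformly continuous on $\Lambda$, is equi-continuous in $\Lambda$ if for any $\epsilon>0$ there exists $\delta>0$ such that $|h_n(x)-h_n(y)|<\epsilon$ for all $n\ge 0$ and all $x,y\in\Lambda$ with $|x-y|<\delta$. Lyapunov exponent at $x_0\in I$: $\lambda(x_0):=\limsup_{n\to\infty}\frac1n\ln|(f_0^n)'(x_0)|=\limsup_{n\to\infty}\frac1n\sum_{k=0}^{n-1}\ln|f_k'(x_k)|$, where $x_k=f_0^k(x_0)$. Strong sensitivity at a point: the system is strongly sensitive at a (non-isolated) point $x_0\in I$ with strong sensitivity constant $\delta>0$ if there exists a neighborhood $U$ of $x_0$ in $I$ such that for every $y_0\in U$ with $y_0\ne x_0$,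 $|f_0^N(y_0)-f_0^N(x_0)|>\delta$ for some positive integer $N$. Strong sensitivity in a set: the system is strongly sensitive in a nonempty set $S\subset I$ without isolated points if there exists a constant $\delta>0$ such that it is strongly sensitive at every point of $S$ with strong sensitivity constant $\delta$ (the neighborhood $U$ may depend on the point).
   Formalization: With neighborhoods U taken in I, the claim can fail at an endpoint of Λ accumulated by I∖Λ. Strong sensitivity is proved at all points of Λ with U a neighborhood in Λ, and with U a neighborhood in I only at points of which Λ is a neighborhood in I. *)

(* Defs.v *)
From HB Require Import structures.
From mathcomp Require Export all_boot all_order all_algebra.
From mathcomp Require Export all_classical all_reals all_analysis.
Export Order.TTheory GRing.Theory Num.Theory.
Export numFieldNormedType.Exports.

Set Implicit Arguments.
Unset Strict Implicit.
Unset Printing Implicit Defensive.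

Local Open Scope classical_set_scope.
Local Open Scope ring_scope.

(* A map on a subset I of R is represented by a total function R -> R that is
   only ever evaluated on I.  In particular all derivatives are relative to I:
   the difference quotients range over points of I, so that at an endpoint of an
   interval I the derivative is the one-sided one. *)

Definition nondegenerate (R : realType) (I : set R) : Prop :=
  exists x y, [/\ I x, I y & x < y].

Definition diff_quot_in (R : realType) (I : set R) (f : R -> R) (x : R)
    : set_system R :=
  (f y - f x) / (y - x) @[y --> within I x^'].

Definition derivable_in (R : realType) (I : set R) (f : R -> R) (x : R)
    : Prop :=
  cvg (diff_quot_in I f x).

Definition derive_in (R : realType) (I : set R) (f : R -> R) (x : R) : R :=
  lim (diff_quot_in I f x).

Definition C1_in (R : realType) (I : set R) (f : R -> R) : Prop :=
  (forall x, I x -> derivable_in I f x) /\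
  {within I, continuous (derive_in I f)}.

(* orbit_map f n is f_(n-1) \o ... \o f_0. *)
Fixpoint orbit_map (R : realType) (f : nat -> R -> R) (n : nat) : R -> R :=
  match n with
  | 0%N => id
  | m.+1 => f m \o orbit_map f m
  end.

(* The uniform continuity on L of each individual h n is part of the condition;
   the notion is uniform over L, unlike the library's pointwise
   [equicontinuous]. *)
Definition equi_continuous_in (R : realType) (L : set R) (h : nat -> R -> R)
    : Prop :=
  forall e : R, 0 < e -> exists2 d : R, 0 < d &
    forall (n : nat) (x y : R), L x -> L y -> `|x - y| < d ->
      `|h n x - h n y| < e.

(* Extended-real valued, with lne 0 = -oo; the term n = 0 does not affect the
   limsup. *)
Definition lyapunov (R : realType) (I : set R) (f : nat -> R -> R) (x : R)
    : \bar R :=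
  limn_esup (fun n : nat =>
    ((n%:R^-1)%:E * lne (`|derive_in I (orbit_map f n) x|%:E))%E).

(* X is the state space of the system: neighborhoods of x0 are taken in X. *)
Definition strongly_sensitive_at (R : realType) (X : set R) (f : nat -> R -> R)
    (d : R) (x0 : R) : Prop :=
  exists2 U : set R, within X (nbhs x0) U &
    forall y0, X y0 -> U y0 -> y0 != x0 ->
      exists2 N : nat, (0 < N)%N &
        d < `|orbit_map f N y0 - orbit_map f N x0|.

Definition strongly_sensitive_in (R : realType) (X : set R) (f : nat -> R -> R)
    (S : set R) : Prop :=
  [/\ S !=set0, S `<=` X, isolated S = set0 &
    exists2 d : R, 0 < d & forall x0, S x0 -> strongly_sensitive_at X f d x0].

(* The points of L of which L is a neighborhood in I; this is L itself when L is
   open in I.  Strong sensitivity in I may fail at the other points of L, where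
   nothing controls f_n on the side of I \ L: take I = R, L = [0, +oo[,
   f_n x = 2 x for x >= 0 and f_n x = 2 x / (1 - 2 (n + 1) x) for x < 0.  Each
   f_n is C^1 and maps ]-oo, 0[ into ]- 1 / (n + 1), 0[, so orbits of small
   negative points stay uniformly close to the fixed point 0. *)
Definition interior_in (R : realType) (I L : set R) : set R :=
  [set x | L x /\ within I (nbhs x) L].

(* Main.v *)
Require Import Defs.
From mathcomp Require Import ring lra.

Set Implicit Arguments.
Unset Strict Implicit.
Unset Printing Implicit Defensive.

(** A positive Lyapunov exponent makes the derivatives of the iterates at [x]
    exceed [expR (c * n)] for infinitely many [n], where [c > 0] is any number
    below the infimum [lambda].  This is information about the orbit of [x]
    alone.  It is transferred to a nearby orbit by bounded distortion: since
    the [f_n'] are equi-continuous and bounded away from [0] on [L], there is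
    one [d > 0] such that [expR (- c / 2) * |f_n' x| <= |f_n' z|] for all [n]
    and all [x], [z] in [L] at distance less than [d]
    ([ler_norm_distortion]).

    Suppose that the orbits of [x] and [y <> x] in [L] stay less than [d]
    apart.  By the mean value theorem, the distance between them is multiplied
    at time [k] by some [|f_k' z|] with [z] between the two orbit points, hence
    by at least [expR (- c / 2) * |f_k' x_k|].  With the chain rule this yields
    [expR (- c / 2) ^+ n * |(f_0^n)' x| * |x - y| < d] for all [n]
    ([orbit_expansion]), so [(f_0^n)' x] grows at most like [expR (c / 2 * n)]
    and the Lyapunov exponent at [x] is at most [c] ([limn_esup_growth_rate]),
    which contradicts the choice of [c].  Hence any two distinct orbits that
    start in [L] at distance less than [d] are at some later time more than
    [d / 2] apart ([orbit_separation]).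

    Both conclusions follow: a neighbourhood in [L] of a point of [L] consists
    of points of [L], and so does, after shrinking, a neighbourhood in [I] of a
    point where [L] is a neighbourhood in [I].

    Derivatives are taken relative to [I].  Such a derivative is handled through
    its Caratheodory slope function, which gives continuity, the chain rule and,
    at interior points, the link with the usual derivative. *)

Local Open Scope classical_set_scope.
Local Open Scope ring_scope.

(** * Limit points of intervals *)

Lemma is_interval_nbhs (R : realType) (I : set R) (a b x : R) :
  is_interval I -> I a -> I b -> a < x < b -> nbhs x I.
Proof.
move=> Iitv Ia Ib /andP[ax xb].
have xab : x \in `]a, b[ by rewrite in_itv/= ax xb.
apply: filterS (near_in_itvoo xab) => z /=; rewrite in_itv/= => /andP[az zb].
by apply: (Iitv a b) => //; rewrite !ltW.
Qed.

Lemma nondegenerate_neq (R : realType) (L : set R) (x : R) :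
  nondegenerate L -> exists2 y, L y & y != x.
Proof.
move=> [a [b [La Lb ab]]]; have [ax|ax] := eqVneq a x.
  by exists b => //; rewrite -ax gt_eqF.
by exists a.
Qed.

(** Moving from [x] towards another point of [L] by a factor [t < 1] stays
    strictly inside [L]; stating the result for the interior covers at once
    every set between the interior of [L] and [L]. *)
Lemma interior_limit_point (R : realType) (L : set R) (x : R) :
  is_interval L -> nondegenerate L -> L x -> limit_point L° x.
Proof.
move=> Litv Lnd Lx U /nbhs_ballP[e /= e0 xeU].
have [y Ly yx] := nondegenerate_neq x Lnd.
have d0 : 0 < `|y - x| by rewrite normr_gt0 subr_eq0.
(* t < 1 keeps the point inside L, t <= e / (2 * `|y - x|) within e of x. *)
pose t := Num.min (2^-1) (e / (2 * `|y - x|)).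
have t0 : 0 < t by rewrite lt_min invr_gt0 divr_gt0 ?mulr_gt0//= ltr0n.
have t1 : t < 1.
  by rewrite gt_min invf_lt1 ?ltr1n// ltr0n.
exists (x + t * (y - x)); split.
- by rewrite -subr_eq0 addrC addKr mulf_neq0 ?subr_eq0// gt_eqF.
- have [xy|xy] := ltP x y.
    apply: (is_interval_nbhs Litv Lx Ly); nra.
  have {}xy : y < x by rewrite lt_neqAle yx.
  apply: (is_interval_nbhs Litv Ly Lx); nra.
- apply: xeU; rewrite /ball/= opprD addNKr normrN normrM (gtr0_norm t0).
  apply: (@le_lt_trans _ _ (e / 2)); last by lra.
  have : t <= e / (2 * `|y - x|) by rewrite ge_min lexx orbT.
  by rewrite ler_pdivlMr ?mulr_gt0//; lra.
Qed.

Lemma is_interval_isolated_eq0 (R : realType) (L S : set R) :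
  is_interval L -> nondegenerate L -> L° `<=` S -> S `<=` L ->
  isolated S = set0.
Proof.
move=> Litv Lnd LS SL; apply/seteqP; split => // x [/set_mem Sx [V Vx VSx]].
have [y [yx Ly Vy]] := interior_limit_point Litv Lnd (SL _ Sx) Vx.
have : [set x] y by rewrite -VSx; split => //; exact: LS.
by move=> /= yxE; rewrite yxE eqxx in yx.
Qed.

(** Makes limits of difference quotients relative to [I] unique, at the
    endpoints of [I] too. *)
Lemma within_dnbhs_ProperFilter (R : realType) (I : set R) (x : R) :
  is_interval I -> nondegenerate I -> I x -> ProperFilter (within I x^').
Proof.
move=> Iitv Ind Ix; split; last exact: within_filter.
move=> W.
have Wx : nbhs x [set z | z != x -> I z -> False] by exact: W.
have [y [yx Iy]] := interior_limit_point Iitv Ind Ix Wx.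
by apply => //; exact: interior_subset.
Qed.

(** * Derivatives relative to an interval *)

(** Replacing the quotient by a slope function [g] removes the division, so
    that no case distinction on [f z = f x] is needed in the chain rule. *)
Lemma diff_quot_in_caratheodory (R : realType) (I : set R) (f : R -> R)
    (x a : R) :
  diff_quot_in I f x --> a <->
  exists g : R -> R, [/\ forall z, f z - f x = g z * (z - x),
    g z @[z --> within I (nbhs x)] --> a & g x = a].
Proof.
split=> [fxa|[g [fg ga gx]]].
  exists (fun z => if z == x then a else (f z - f x) / (z - x)); split.
  - move=> z; case: eqVneq => [->|zx]; first by rewrite !subrr mulr0.
    by rewrite divfK// subr_eq0.
  - move=> V Va; have {}Va : nbhs a V by exact: Va.
    have Vf : nbhs x [set z | z != x -> I z -> V ((f z - f x) / (z - x))].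
      exact: (fxa V Va).
    change (nbhs x [set z | I z ->
      V (if z == x then a else (f z - f x) / (z - x))]).
    apply: filterS Vf => z Vz Iz; case: eqVneq => [_|zx]; last exact: Vz.
    exact: nbhs_singleton Va.
  - by rewrite eqxx.
move=> V /ga Vg; have {}Vg : nbhs x [set z | I z -> V (g z)] by exact: Vg.
change (nbhs x [set z | z != x -> I z -> V ((f z - f x) / (z - x))]).
by apply: filterS Vg => z Vz zx Iz; rewrite fg mulfK ?subr_eq0//; exact: Vz.
Qed.

Lemma diff_quot_in_continuous (R : realType) (I : set R) (f : R -> R)
    (x a : R) :
  diff_quot_in I f x --> a -> f z @[z --> within I (nbhs x)] --> f x.
Proof.
move=> /diff_quot_in_caratheodory[g [fg ga gx]].
have -> : f = (fun z => f x + g z * (z - x)).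
  by apply/funext => z; rewrite -fg addrC subrK.
rewrite subrr mulr0 addr0 -[X in _ --> X]addr0.
apply: cvgD; first exact: cvg_cst.
rewrite -(mulr0 a); apply: cvgM => //.
rewrite -(subrr x); apply: cvgB; last exact: cvg_cst.
exact: cvg_within.
Qed.

Lemma diff_quot_in_comp (R : realType) (I : set R) (f h : R -> R) (x a b : R) :
  (forall z, I z -> I (h z)) ->
  diff_quot_in I h x --> a -> diff_quot_in I f (h x) --> b ->
  diff_quot_in I (f \o h) x --> b * a.
Proof.
move=> Ih hxa /diff_quot_in_caratheodory[gf [fg gfb gfx]].
have hc := diff_quot_in_continuous hxa.
move/diff_quot_in_caratheodory : hxa => [gh [hg gha ghx]].
apply/diff_quot_in_caratheodory; exists (fun z => gf (h z) * gh z); split.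
- by move=> z /=; rewrite fg hg mulrA.
- apply: cvgM => //; apply: cvg_comp gfb => V Vh.
  have hV : nbhs x [set z | I z -> I (h z) -> V (h z)] by exact: (hc _ Vh).
  change (nbhs x [set z | I z -> V (h z)]).
  by apply: filterS hV => z + Iz; apply => //; exact: Ih.
- by rewrite gfx ghx.
Qed.

Lemma derivable_in_cvg (R : realType) (I : set R) (f : R -> R) (x : R) :
  derivable_in I f x -> diff_quot_in I f x --> derive_in I f x.
Proof. by []. Qed.

(** Strictly between two points of [I] the relative derivative is the ordinary
    one, and at the endpoints only continuity is required, so the classical mean
    value theorem applies. *)
Lemma MVT_in (R : realType) (I : set R) (f : R -> R) (a b : R) :
  is_interval I -> (forall x, I x -> derivable_in I f x) ->
  I a -> I b -> a < b ->
  exists2 c, a < c < b & f b - f a = derive_in I f c * (b - a).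
Proof.
move=> Iitv fI Ia Ib ab.
have Iab : `[a, b]%classic `<=` I.
  by move=> z /=; rewrite in_itv/=; exact: Iitv.
have [||c] := @MVT R f (derive_in I f) a b ab; last first.
- by rewrite in_itv/=; exists c.
- apply/subspace_continuousP => x /Iab Ix.
  have := diff_quot_in_continuous (derivable_in_cvg (fI x Ix)).
  by apply: cvg_trans; apply: cvg_app; exact: within_subset.
- move=> x; rewrite in_itv/= => axb.
  have Inx := is_interval_nbhs Iitv Ia Ib axb.
  have Ix : I x by exact: nbhs_singleton.
  have /diff_quot_in_caratheodory[g [fg ga gx]] := derivable_in_cvg (fI x Ix).
  apply/is_derive1_caratheodory; exists g; split => //.
  rewrite /prop_for /continuous_at gx => V /ga Vg.
  have {}Vg : nbhs x [set z | I z -> V (g z)] by exact: Vg.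
  by apply: filterS (filterI Inx Vg) => z [Iz]; apply.
Qed.

(** Form of the mean value theorem that is insensitive to the order of [x] and
    [y] and to [x = y].  That [c] lies between [x] and [y] is expressed by its
    membership in every interval that contains both. *)
Lemma MVT_in_norm (R : realType) (I : set R) (f : R -> R) (x y : R) :
  is_interval I -> (forall x, I x -> derivable_in I f x) -> I x -> I y ->
  exists c, [/\ `|x - c| <= `|x - y|,
    forall L, is_interval L -> L x -> L y -> L c &
    `|f x - f y| = `|derive_in I f c| * `|x - y|].
Proof.
move=> Iitv fI Ix Iy; case: (ltgtP x y) => [xy|yx|<-].
- have [c /andP[xc cy] fxy] := MVT_in Iitv fI Ix Iy xy.
  exists c; split.
  + by rewrite !ltr0_norm ?subr_lt0//; lra.
  + by move=> L Litv Lx Ly; apply: (Litv x y) => //; rewrite !ltW.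
  + by rewrite -normrM distrC fxy !normrM (distrC x).
- have [c /andP[yc cx] fxy] := MVT_in Iitv fI Iy Ix yx.
  exists c; split.
  + by rewrite !gtr0_norm ?subr_gt0//; lra.
  + by move=> L Litv Lx Ly; apply: (Litv y x) => //; rewrite !ltW.
  + by rewrite -normrM fxy.
- by exists x; split => //; rewrite !subrr !normr0 mulr0.
Qed.

(** * Orbits *)

Lemma orbit_map_in (R : realType) (A : set R) (f : nat -> R -> R) (n : nat)
    (x : R) :
  (forall n, f n @` A `<=` A) -> A x -> A (orbit_map f n x).
Proof.
move=> fA Ax; elim: n => //= n IH.
by apply: (fA n); exists (orbit_map f n x).
Qed.

Lemma derive_in_orbit_map (R : realType) (I : set R) (f : nat -> R -> R)
    (n : nat) (x : R) :
  is_interval I -> nondegenerate I -> (forall n, f n @` I `<=` I) ->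
  (forall n y, I y -> derivable_in I (f n) y) -> I x ->
  derive_in I (orbit_map f n) x =
  \prod_(k < n) derive_in I (f k) (orbit_map f k x).
Proof.
move=> Iitv Ind fI fd Ix.
have PF := within_dnbhs_ProperFilter Iitv Ind Ix.
apply: (cvg_lim (@norm_hausdorff _ R)).
elim: n => [|n IH].
  rewrite big_ord0; apply/diff_quot_in_caratheodory; exists (cst 1).
  by split => // [z|]; [rewrite mul1r|exact: cvg_cst].
rewrite big_ord_recr/= mulrC; apply: diff_quot_in_comp IH _ => [z Iz|].
  exact: orbit_map_in.
by apply: derivable_in_cvg; apply: fd; exact: orbit_map_in.
Qed.

(** * Exponential growth rates *)

Lemma limn_esup_le_near (R : realType) (u : nat -> \bar R) (c : \bar R) :
  (\forall n \near \oo, (u n <= c)%E) -> (limn_esup u <= c)%E.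
Proof.
move=> uc; apply: (@le_trans _ _ (ereal_sup (u @` [set n | (u n <= c)%E]))).
  by apply: ereal_inf_lbound; exists [set n | (u n <= c)%E].
by apply: ge_ereal_sup => _ [n /= unc <-].
Qed.

(** The constant [K] contributes [ln K / n] to the [n]-th term, which is
    eventually below the margin [c - b]. *)
Lemma limn_esup_growth_rate (R : realType) (D : nat -> R) (K b c : R) :
  b < c -> (forall n, `|D n| <= K * expR b ^+ n) ->
  (limn_esup (fun n => (n%:R^-1)%:E * lne (`|D n|%:E))%E <= c%:E)%E.
Proof.
move=> bc DK.
(* A positive constant is needed to take its logarithm. *)
pose K' := Num.max K 1.
have K'0 : 0 < K' by rewrite lt_max ltr01 orbT.
apply: limn_esup_le_near.
near=> n.
have n0 : (0 < n%:R :> R) by rewrite ltr0n; near: n; exact: nbhs_infty_gt.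
have Dn : (lne (`|D n|%:E) <= (ln K' + b * n%:R)%:E)%E.
  have -> : b * n%:R = ln (expR b ^+ n) by rewrite -expRM_natl expRK mulrC.
  rewrite -lnM ?posrE ?exprn_gt0 ?expR_gt0// -lne_EFin; last first.
    by rewrite mulr_gt0 ?exprn_gt0 ?expR_gt0.
  rewrite lee_lne ?in_itv/= ?leey ?lee_fin ?normr_ge0//; last first.
    by rewrite mulr_ge0 ?exprn_ge0 ?expR_ge0// ltW.
  apply: le_trans (DK n) _.
  by rewrite ler_wpM2r ?exprn_ge0 ?expR_ge0// le_max lexx.
apply: (@le_trans _ _ ((n%:R^-1)%:E * (ln K' + b * n%:R)%:E)%E).
  by apply: lee_wpmul2l => //; rewrite lee_fin invr_ge0 ltW.
rewrite -EFinM lee_fin mulrC ler_pdivrMr//.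
have : ln K' / (c - b) <= n%:R by near: n; exact: nbhs_infty_ger.
rewrite ler_pdivrMr ?subr_gt0//; lra.
Unshelve. all: by end_near. Qed.

(** * Expansion along orbits *)

(** An absolute error on the derivative becomes a relative one because [M]
    bounds the derivative from below: [v] differs from [u] by at most
    [|u| * (1 - q)]. *)
Lemma ler_norm_distortion (R : realType) (u v M q : R) :
  q <= 1 -> M <= `|u| -> `|u - v| < M * (1 - q) -> q * `|u| <= `|v|.
Proof.
move=> q1 Mu uv; have uvD : `|u| - `|v| <= `|u - v| by exact: lerB_dist.
have : M * (1 - q) <= `|u| * (1 - q) by rewrite ler_wpM2r// subr_ge0.
by lra.
Qed.

(** While two orbits are less than [d] apart, each step loses at most a factor
    [q] with respect to the derivative at the reference orbit. *)
Lemma orbit_expansion (R : realType) (I L : set R) (f : nat -> R -> R)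
    (d q : R) :
  is_interval I -> (forall n x, I x -> derivable_in I (f n) x) ->
  is_interval L -> L `<=` I -> (forall n, f n @` L `<=` L) -> 0 <= q ->
  (forall n x c, L x -> L c -> `|x - c| < d ->
    q * `|derive_in I (f n) x| <= `|derive_in I (f n) c|) ->
  forall (x y : R) (n : nat), L x -> L y ->
    (forall k, (k < n)%N -> `|orbit_map f k x - orbit_map f k y| < d) ->
  q ^+ n * `|\prod_(k < n) derive_in I (f k) (orbit_map f k x)| * `|x - y|
    <= `|orbit_map f n x - orbit_map f n y|.
Proof.
move=> Iitv fd Litv LI fL q0 fq x y n Lx Ly.
elim: n => [_|n IH xyd]; first by rewrite big_ord0 expr0 normr1 !mul1r.
have Lxn := orbit_map_in n fL Lx; have Lyn := orbit_map_in n fL Ly.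
have [c [xc Lc /= ->]] := MVT_in_norm Iitv (fd n) (LI _ Lxn) (LI _ Lyn).
have {}Lc := Lc L Litv Lxn Lyn.
rewrite big_ord_recr/= normrM exprS.
rewrite [leLHS](_ : _ = (q * `|derive_in I (f n) (orbit_map f n x)|) *
  (q ^+ n * `|\prod_(k < n) derive_in I (f k) (orbit_map f k x)| *
   `|x - y|)); last by ring.
apply: ler_pM.
- exact: mulr_ge0.
- by rewrite !mulr_ge0// exprn_ge0.
- by apply: fq => //; apply: le_lt_trans xc _; exact: xyd.
- by apply: IH => k kn; apply: xyd; exact: ltnW.
Qed.

(** If the orbits never separated, the expansion estimate would bound the
    derivatives of the iterates at [x] by a multiple of [expR b ^+ n], and the
    exponent at [x] would be at most [c].  The threshold [d / 2] makes the
    negated conclusion a bound strictly below [d]. *)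
Lemma orbit_separation (R : realType) (I L : set R) (f : nat -> R -> R)
    (d b c x y : R) :
  is_interval I -> nondegenerate I -> (forall n, f n @` I `<=` I) ->
  (forall n x, I x -> derivable_in I (f n) x) ->
  is_interval L -> L `<=` I -> (forall n, f n @` L `<=` L) ->
  (forall n x c, L x -> L c -> `|x - c| < d ->
    expR (- b) * `|derive_in I (f n) x| <= `|derive_in I (f n) c|) ->
  b < c -> (c%:E < lyapunov I f x)%E -> 0 < d ->
  L x -> L y -> y != x -> `|y - x| < d ->
  exists2 N : nat, (0 < N)%N & d / 2 < `|orbit_map f N y - orbit_map f N x|.
Proof.
move=> Iitv Ind fI fd Litv LI fL fq bc cx d0 Lx Ly yx yxd.
apply: contrapT => noN.
have xyd n : `|orbit_map f n x - orbit_map f n y| < d.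
  case: n => [|n]; first by rewrite /= distrC.
  rewrite distrC ltNge; apply/negP => dxy; apply: noN; exists n.+1 => //.
  by apply: lt_le_trans dxy; lra.
have xy0 : 0 < `|x - y| by rewrite normr_gt0 subr_eq0 eq_sym.
move: cx; apply/negP; rewrite -leNgt.
apply: (@limn_esup_growth_rate _ _ (d / `|x - y|) _ _ bc) => n.
rewrite derive_in_orbit_map//; last exact: LI.
have := orbit_expansion Iitv fd Litv LI fL (expR_ge0 (- b)) fq Lx Ly
  (fun k (_ : (k < n)%N) => xyd k).
move=> /le_lt_trans/(_ (xyd n))/ltW.
rewrite expRN exprVn -ler_pdivlMr// mulrC ler_pdivrMr//.
by rewrite exprn_gt0// expR_gt0.
Qed.

Theorem theorem3p2 (R : realType) (I L : set R) (f : nat -> R -> R)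
  (I_itv : is_interval I) (I_nondeg : nondegenerate I)
  (f_maps : forall n : nat, f n @` I `<=` I)
  (f_C1 : forall n : nat, C1_in I (f n))
  (L_itv : is_interval L) (L_nondeg : nondegenerate L) (L_sub : L `<=` I)
  (L_inv : forall n : nat, f n @` L `<=` L)
  (f'_equi : equi_continuous_in L (fun n : nat => derive_in I (f n)))
  (f'_low : exists2 M : R, 0 < M &
     forall (x : R) (n : nat), L x -> M <= `|derive_in I (f n) x|)
  (lambda_gt0 : (0 < ereal_inf [set lyapunov I f x | x in L])%E) :
  strongly_sensitive_in L f L /\ strongly_sensitive_in I f (interior_in I L).
Proof.
have fd n x : I x -> derivable_in I (f n) x by exact: (f_C1 n).1.
have [M M0 f'M] := f'_low.
have [c c0 c_lt] : exists2 c : R, 0 < c &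
    (c%:E < ereal_inf [set lyapunov I f x | x in L])%E.
  case: (ereal_inf _) lambda_gt0 => [l|_|//]; last by exists 1; rewrite ?ltry.
  by rewrite lte_fin => l0; exists (l / 2); rewrite ?lte_fin; lra.
(* Half of c is spent on distortion, half is left for the growth. *)
pose q := expR (- (c / 2)).
have q1 : q < 1 by rewrite expR_lt1; lra.
have [d d0 f'd] : exists2 d : R, 0 < d & forall n x y, L x -> L y ->
    `|x - y| < d -> `|derive_in I (f n) x - derive_in I (f n) y| < M * (1 - q).
  by apply: f'_equi; rewrite mulr_gt0// subr_gt0.
have sep x y (Lx : L x) : L y -> y != x -> `|y - x| < d ->
    exists2 N, (0 < N)%N & d / 2 < `|orbit_map f N y - orbit_map f N x|.
  move=> Ly yx yxd.
  apply: (@orbit_separation R I L f d (c / 2) c) => //.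
  - move=> n x' z Lx' Lz xz; apply: ler_norm_distortion (ltW q1) _ _.
      exact: f'M.
    exact: f'd.
  - by lra.
  - apply: lt_le_trans c_lt _; apply: ereal_inf_lbound.
    by exists x.
have near_d A x : within A (nbhs x) [set y | `|y - x| < d].
  change (nbhs x [set y | A y -> `|y - x| < d]).
  by apply: filterS (nbhsx_ballx x d d0) => y; rewrite -ball_normE /= distrC.
have d20 : 0 < d / 2 by lra.
have intLI : L° `<=` interior_in I L.
  move=> x Lx; split; first exact: interior_subset.
  by apply: filterS Lx => z Lz _.
split; split.
- by have [a [b [La _ _]]] := L_nondeg; exists a.
- by [].
- apply: (is_interval_isolated_eq0 L_itv L_nondeg) => //.
  exact: interior_subset.
- exists (d / 2) => // x Lx; exists [set y | `|y - x| < d].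
    exact: near_d.
  by move=> y Ly yxd yx; exact: sep.
- have [a [b [La _ _]]] := L_nondeg.
  have [y [_ Ly _]] := interior_limit_point L_itv L_nondeg La filterT.
  by exists y; exact: intLI.
- by move=> x [/L_sub].
- by apply: (is_interval_isolated_eq0 L_itv L_nondeg) => // x [].
- exists (d / 2) => // x [Lx ILx].
  exists (L `&` [set y | `|y - x| < d]).
    apply: (@filterI _ (within I (nbhs x))) => //; exact: near_d.
  by move=> y Iy [Ly yxd] yx; exact: sep.
Qed.
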